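(* Let $G$ be a group together with a word norm $\|\cdot\|$ generated by finitely many conjugacy classes. Let $\psi:G\to\mathbb{R}$ be a non-trivial homogeneous quasimorphism, let $\omega$ be a non-principal ultrafilter on $\mathbb{N}$, and let $\widehat\psi:\mathrm{Cone}_\omega(G,\|\cdot\|)\to\mathbb{R}$ be the map induced by $\psi$, $\widehat\psi([x_n])=\lim_\omega\psi(x_n)/n$. Then: (i) There is an induced short exact sequence of groups $$1\to\ker\widehat\psi\to\mathrm{Cone}_\omega(G,\|\cdot\|)\xrightarrow{\widehat\psi}\mathbb{R}\to1.$$ (ii) There exists a Lipschitz continuous right section $s:\mathbb{R}\to\mathrm{Cone}_\omega(G,\|\cdot\|)$ of $\widehat\psi$ that is a group homomorphism. (iii) This short exact sequence is topologically split; that is, there exists a homeomorphism $\mathrm{Cone}_\omega(G,\|\cdot\|)\cong\ker\widehat\psi\times\mathbb{R}$.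
   Context: A quasimorphism is a map $\psi:G\to\mathbb{R}$ for which there is $D\ge0$ with $|\psi(gh)-\psi(g)-\psi(h)|\le D$ for all $g,h\in G$; it is homogeneous if $\psi(g^n)=n\psi(g)$ for all $g\in G$, $n\in\mathbb{Z}$; non-trivial means not identically zero. A word norm generated by finitely many conjugacy classes on $G$ is $g\mapsto\min\{m\ge0\mid g=t_1\cdots t_m,\ t_i\in T\}$, where $T=T^{-1}$ is a generating set which is a union of finitely many conjugacy classes. It induces the metric $d(g,h)=\|gh^{-1}\|$. Asymptotic cone (scaling sequence $s_n=n$): a sequence $(x_n)_{n\ge1}$ in $G$ is admissible if $\|x_n\|/n$ is bounded; $\mathrm{Cone}_\omega(G,\|\cdot\|)$ is the set of admissible sequences modulo $(x_n)\sim(y_n)$ iff $\lim_\omega d(x_n,y_n)/n=0$, with metric $\lim_\omega d(x_n,y_n)/n$, and is a topological group under termwise multiplication. $\mathbb{R}$ carries its usual metric (it is identified with the cone of $(\mathbb{Z},|\cdot|)$). *)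

(* Defs.v *)
From HB Require Import structures.
From mathcomp Require Import all_boot all_order all_algebra.
From mathcomp Require Import all_classical all_reals all_analysis.
From mathcomp Require Import generic_quotient lra.

Set Implicit Arguments.
Unset Strict Implicit.
Unset Printing Implicit Defensive.

Import Order.TTheory GRing.Theory Num.Theory.
Import numFieldNormedType.Exports.

Local Open Scope classical_set_scope.
Local Open Scope ring_scope.

Section WordNorm.
Local Open Scope group_scope.
Context {G : groupType}.

Definition conj_class (g : G) : set G := range (conjg g).

Definition is_word (T : set G) (g : G) (ts : seq G) : Prop :=
  (forall t, t \in ts -> T t) /\ g = \prod_(t <- ts) t.

(* Since T is symmetric, T generates G as a group exactly when every element
   of G is the product of a word in T. *)
Record conj_gen_set := ConjGenSet {
  cgs_set : set G;
  cgs_sym : forall t, cgs_set t -> cgs_set t^-1;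
  cgs_fin : exists reps : seq G,
    cgs_set = \bigcup_(g in [set` reps]) conj_class g;
  cgs_gen : forall g, exists ts, is_word cgs_set g ts }.

Variable T : conj_gen_set.

Definition word_of_size (g : G) : pred nat :=
  fun m => `[< exists2 ts, is_word (cgs_set T) g ts & size ts = m >].

Fact word_of_size_ex g : exists m, word_of_size g m.
Proof.
by have [ts ?] := cgs_gen T g; exists (size ts); apply/asboolP; exists ts.
Qed.

Definition word_norm (g : G) : nat := ex_minn (word_of_size_ex g).

Lemma word_normP g : exists2 ts, is_word (cgs_set T) g ts & size ts = word_norm g.
Proof. by rewrite /word_norm; case: ex_minnP => m /asboolP. Qed.

Lemma word_norm_le g ts : is_word (cgs_set T) g ts -> (word_norm g <= size ts)%N.
Proof.
rewrite /word_norm; case: ex_minnP => m _ + gts; apply.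
by apply/asboolP; exists ts.
Qed.

Lemma cgs_conj t h : cgs_set T t -> cgs_set T (t ^ h).
Proof.
have [reps ->] := cgs_fin T; move=> [g gr [k _ <-]]; exists g => //.
by exists (k * h) => //; rewrite conjgM.
Qed.

Lemma word_norm1 : word_norm 1 = 0%N.
Proof.
apply/eqP; rewrite -leqn0; apply: (@word_norm_le 1 [::]).
by split; [|rewrite big_nil].
Qed.

Lemma word_normM g h : (word_norm (g * h) <= word_norm g + word_norm h)%N.
Proof.
have [s [Ts gE] <-] := word_normP g; have [t [Tt hE] <-] := word_normP h.
rewrite -size_cat; apply: word_norm_le; split; last first.
  by rewrite big_cat/= -gE -hE.
by move=> x; rewrite mem_cat => /orP[/Ts|/Tt].
Qed.

Lemma word_normV_le g : (word_norm g^-1 <= word_norm g)%N.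
Proof.
have [s [Ts gE] <-] := word_normP g.
rewrite -size_rev -(size_map (fun x : G => x^-1)).
apply: word_norm_le; split; last first.
  by rewrite big_map (prodgV _ xpredT id) revK -gE.
by move=> x /mapP[y]; rewrite mem_rev => /Ts Ty ->; exact: cgs_sym.
Qed.

Lemma word_normV g : word_norm g^-1 = word_norm g.
Proof.
apply/eqP; rewrite eqn_leq word_normV_le/=.
by rewrite -{1}(invgK g) word_normV_le.
Qed.

Lemma word_normJ_le g h : (word_norm (g ^ h) <= word_norm g)%N.
Proof.
have [s [Ts gE] <-] := word_normP g.
rewrite -(size_map (fun x => x ^ h)); apply: word_norm_le; split; last first.
  by rewrite big_map gE conjg_prod.
by move=> x /mapP[y /Ts Ty ->]; exact: cgs_conj.
Qed.

Lemma word_normJ g h : word_norm (g ^ h) = word_norm g.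
Proof.
apply/eqP; rewrite eqn_leq word_normJ_le/=.
by rewrite -{1}(conjgK h g) word_normJ_le.
Qed.

Definition word_dist (g h : G) : nat := word_norm (g / h).

Lemma word_distxx g : word_dist g g = 0%N.
Proof. by rewrite /word_dist mulgV word_norm1. Qed.

Lemma word_distC g h : word_dist g h = word_dist h g.
Proof. by rewrite /word_dist -word_normV invgF. Qed.

Lemma word_dist_triangle h g k :
  (word_dist g k <= word_dist g h + word_dist h k)%N.
Proof. by rewrite /word_dist -(divgKA h g) word_normM. Qed.

Lemma word_distM g g' h h' :
  (word_dist (g * h) (g' * h') <= word_dist g g' + word_dist h h')%N.
Proof.
rewrite (leq_trans (word_dist_triangle (g * h') _ _))// addnC leq_add//.
  by rewrite /word_dist mulgKA.
rewrite /word_dist -(word_normJ (h / h') g^-1) conjgE invgK invgM.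
by rewrite !mulgA.
Qed.

Lemma word_distV g h : word_dist g^-1 h^-1 = word_dist g h.
Proof.
rewrite (word_distC g h) /word_dist invgK -(word_normJ (h / g) g).
by rewrite conjgE mulgVK.
Qed.

Lemma word_dist_le g h : (word_dist g h <= word_norm g + word_norm h)%N.
Proof. by rewrite /word_dist (leq_trans (word_normM _ _))// word_normV. Qed.

End WordNorm.
Arguments conj_gen_set : clear implicits.

Record np_ultrafilter := NpUltrafilter {
  npu_sets : set_system nat;
  npu_ultra : UltraFilter npu_sets;
  npu_nonprincipal : forall n, npu_sets <> principal_filter n }.
#[global] Existing Instance npu_ultra.

Section UltraLimit.
Context {R : realType} (w : np_ultrafilter).
Implicit Types u v : nat -> R.

Definition ulim u : R := lim (u @ npu_sets w).

Lemma npu_neq n : npu_sets w (~` [set n]).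
Proof.
have [wn|//] := in_ultra_setVsetC [set n] (npu_ultra w).
exfalso; apply: (@npu_nonprincipal w n).
have uf := principal_filter_ultra n.
apply: (@max_filter _ _ uf) => A /principal_filterP An.
by apply: filterS wn => _ ->.
Qed.

Lemma npu_ge N : npu_sets w [set n | (N <= n)%N].
Proof.
elim: N => [|N IH]; first by apply: filterS (@filterT _ (npu_sets w) _).
apply: filterS (filterI IH (npu_neq N)) => n [/= Nn /eqP nN].
by rewrite ltn_neqAle eq_sym nN.
Qed.

Lemma npu_cvg u (l : R) : u @ \oo --> l -> u @ npu_sets w --> l.
Proof.
apply: cvg_trans => A [N _ NA].
by apply: filterS (npu_ge N) => n /= /NA.
Qed.

Lemma bounded_ucvg u (C : R) : (forall n, `|u n| <= C) -> u @ npu_sets w --> ulim u.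
Proof.
move=> uC.
suff [p up] : exists p : R, u @ npu_sets w --> p by exact: (cvgP p up).
have [] := @segment_compact R (- C) C (u @ npu_sets w) _.
  apply: (@filterS _ (npu_sets w) _ setT) filterT => n _ /=.
  by rewrite in_itv/= -ler_norml.
move=> p [_ clp]; exists p; apply/cvgrPdist_lt => e e0.
set A := [set n | `|p - u n| < e].
have [//|wA] := in_ultra_setVsetC A (npu_ultra w).
have [_ [[n nA <-]]] := clp (u @` (~` A)) (ball p e)
  (filterS (fun n nA => imageP u nA) wA) (nbhsx_ballx p e e0).
by rewrite /ball/=.
Qed.

Lemma ucvg_lim u (l : R) : u @ npu_sets w --> l -> ulim u = l.
Proof. exact: cvg_lim. Qed.

End UltraLimit.

Section Cone.
Context {R : realType} {G : groupType} (T : conj_gen_set G) (w : np_ultrafilter).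

(* Sequences are indexed by nat; the term of index 0 is irrelevant because
   x / 0 = 0 and w is non-principal. *)
Record adm_seq := AdmSeq {
  adm_fun :> nat -> G;
  adm_bounded : exists C : R,
    forall n, (word_norm T (adm_fun n))%:R / n%:R <= C }.

HB.instance Definition _ := gen_eqMixin adm_seq.
HB.instance Definition _ := gen_choiceMixin adm_seq.

Definition seq_dist (x y : nat -> G) (n : nat) : R :=
  (word_dist T (x n) (y n))%:R / n%:R.

Lemma seq_dist_ge0 x y n : 0 <= seq_dist x y n.
Proof. by rewrite divr_ge0. Qed.

Lemma ler_nat_div (m m' n : nat) :
  (m <= m')%N -> m%:R / n%:R <= m'%:R / n%:R :> R.
Proof. by move=> mm'; rewrite ler_wpM2r ?invr_ge0// ler_nat. Qed.

Lemma seq_dist_cvg (x y : adm_seq) :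
  seq_dist x y @ npu_sets w --> ulim w (seq_dist x y).
Proof.
have [C xC] := adm_bounded x; have [D yD] := adm_bounded y.
apply: (@bounded_ucvg R w _ (C + D)) => n; rewrite ger0_norm ?seq_dist_ge0//.
by rewrite (le_trans (ler_nat_div n (word_dist_le _ _ _)))// natrD mulrDl lerD.
Qed.

Lemma ulim_seq_dist_ge0 (x y : adm_seq) : 0 <= ulim w (seq_dist x y).
Proof.
apply: (limr_ge (@seq_dist_cvg x y)).
by apply: nearW => n; exact: seq_dist_ge0.
Qed.

Lemma ulim_seq_distxx (x : adm_seq) : ulim w (seq_dist x x) = 0.
Proof.
apply: ucvg_lim; rewrite (_ : seq_dist x x = cst 0); first exact: cvg_cst.
by apply/funext => n; rewrite /seq_dist word_distxx mul0r.
Qed.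

Lemma ulim_seq_distC (x y : adm_seq) :
  ulim w (seq_dist x y) = ulim w (seq_dist y x).
Proof.
by congr ulim; apply/funext => n; rewrite /seq_dist word_distC.
Qed.

Lemma ulim_seq_dist_sum (x y x1 y1 x2 y2 : adm_seq) :
  (forall n, (word_dist T (x n) (y n) <=
    word_dist T (x1 n) (y1 n) + word_dist T (x2 n) (y2 n))%N) ->
  ulim w (seq_dist x y) <= ulim w (seq_dist x1 y1) + ulim w (seq_dist x2 y2).
Proof.
move=> H; apply: ler_cvg_to (@seq_dist_cvg x y)
  (cvgD (@seq_dist_cvg x1 y1) (@seq_dist_cvg x2 y2)) _.
apply: nearW => n /=; rewrite (le_trans (ler_nat_div n (H n)))//.
by rewrite natrD mulrDl.
Qed.

Lemma ulim_seq_dist_triangle (y x z : adm_seq) :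
  ulim w (seq_dist x z) <= ulim w (seq_dist x y) + ulim w (seq_dist y z).
Proof. by apply: ulim_seq_dist_sum => n; exact: word_dist_triangle. Qed.

Definition cone_rel (x y : adm_seq) : bool := ulim w (seq_dist x y) == 0.

Fact cone_rel_refl : reflexive cone_rel.
Proof. by move=> x; rewrite /cone_rel ulim_seq_distxx. Qed.

Fact cone_rel_sym : symmetric cone_rel.
Proof. by move=> x y; rewrite /cone_rel ulim_seq_distC. Qed.

Fact cone_rel_trans : transitive cone_rel.
Proof.
move=> y x z /eqP xy /eqP yz; rewrite /cone_rel eq_le ulim_seq_dist_ge0 andbT.
by rewrite (le_trans (ulim_seq_dist_triangle y x z))// xy yz addr0.
Qed.

Canonical cone_equiv :=
  EquivRel cone_rel cone_rel_refl cone_rel_sym cone_rel_trans.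

Definition cone : Type := {eq_quot cone_equiv}%qT.
HB.instance Definition _ := Quotient.on cone.
HB.instance Definition _ := Choice.on cone.

Definition cone_class (x : adm_seq) : cone := \pi_cone%qT x.

Lemma cone_classP x y :
  cone_class x = cone_class y <-> ulim w (seq_dist x y) = 0.
Proof.
by split=> [/eqmodP/eqP//|xy]; apply/eqmodP; rewrite /= /cone_rel xy.
Qed.

Lemma cone_reprK c : cone_class (repr c) = c.
Proof. exact: reprK. Qed.

Lemma cone_repr_dist x : ulim w (seq_dist (repr (cone_class x)) x) = 0.
Proof. by apply/cone_classP; rewrite cone_reprK. Qed.

Definition cone_dist (a b : cone) : R := ulim w (seq_dist (repr a) (repr b)).

Lemma cone_distE x y :
  cone_dist (cone_class x) (cone_class y) = ulim w (seq_dist x y).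
Proof.
apply/eqP; rewrite eq_le /cone_dist; apply/andP; split.
  rewrite (le_trans (ulim_seq_dist_triangle x _ _))// cone_repr_dist add0r.
  rewrite (le_trans (ulim_seq_dist_triangle y _ _))//.
  by rewrite (ulim_seq_distC y) cone_repr_dist addr0.
rewrite (le_trans (ulim_seq_dist_triangle (repr (cone_class x)) _ _))//.
rewrite ulim_seq_distC cone_repr_dist add0r.
rewrite (le_trans (ulim_seq_dist_triangle (repr (cone_class y)) _ _))//.
by rewrite cone_repr_dist addr0.
Qed.

Fact cone_distxx a : cone_dist a a = 0.
Proof. exact: ulim_seq_distxx. Qed.

Fact cone_dist_pos a b : cone_dist a b = 0 -> a = b.
Proof. by move=> /cone_classP; rewrite !cone_reprK. Qed.

Fact cone_distC a b : cone_dist a b = cone_dist b a.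
Proof. exact: ulim_seq_distC. Qed.

Fact cone_dist_triangle b a c : cone_dist a c <= cone_dist a b + cone_dist b c.
Proof. exact: ulim_seq_dist_triangle. Qed.

HB.instance Definition _ := isMetric.Build R cone
  cone_distxx cone_dist_pos cone_distC cone_dist_triangle.

Fact adm_mul_bounded (x y : adm_seq) : exists C : R,
  forall n, (word_norm T (x n * y n)%g)%:R / n%:R <= C.
Proof.
have [C xC] := adm_bounded x; have [D yD] := adm_bounded y.
exists (C + D) => n; rewrite (le_trans (ler_nat_div n (word_normM _ _ _)))//.
by rewrite natrD mulrDl lerD.
Qed.

Fact adm_inv_bounded (x : adm_seq) : exists C : R,
  forall n, (word_norm T (x n)^-1%g)%:R / n%:R <= C.
Proof.
by have [C xC] := adm_bounded x; exists C => n; rewrite word_normV.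
Qed.

Fact adm_one_bounded : exists C : R,
  forall n, (word_norm T (1%g : G))%:R / n%:R <= C.
Proof. by exists 0 => n; rewrite word_norm1 mul0r. Qed.

Definition adm_mul (x y : adm_seq) : adm_seq := AdmSeq (adm_mul_bounded x y).
Definition adm_inv (x : adm_seq) : adm_seq := AdmSeq (adm_inv_bounded x).
Definition adm_one : adm_seq := AdmSeq adm_one_bounded.

Definition cone_mul (a b : cone) : cone :=
  cone_class (adm_mul (repr a) (repr b)).
Definition cone_inv (a : cone) : cone := cone_class (adm_inv (repr a)).
Definition cone_one : cone := cone_class adm_one.

Lemma cone_mulE x y :
  cone_mul (cone_class x) (cone_class y) = cone_class (adm_mul x y).
Proof.
apply/cone_classP/eqP; rewrite eq_le ulim_seq_dist_ge0 andbT.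
rewrite -[leRHS]addr0 -{1}(cone_repr_dist x) -(cone_repr_dist y).
by apply: ulim_seq_dist_sum => n; exact: word_distM.
Qed.

Lemma cone_invE x : cone_inv (cone_class x) = cone_class (adm_inv x).
Proof.
apply/cone_classP; rewrite -(cone_repr_dist x); congr ulim.
by apply/funext => n; rewrite /seq_dist word_distV.
Qed.

Lemma cone_class_ext (x y : adm_seq) : x =1 y -> cone_class x = cone_class y.
Proof.
move=> xy; apply/cone_classP; rewrite -(ulim_seq_distxx x).
by congr ulim; apply/funext => n; rewrite /seq_dist xy.
Qed.

Fact cone_mulA : associative cone_mul.
Proof.
move=> a b c; rewrite -(cone_reprK a) -(cone_reprK b) -(cone_reprK c) !cone_mulE.
by apply: cone_class_ext => n /=; rewrite mulgA.
Qed.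

Fact cone_mul1 : left_id cone_one cone_mul.
Proof.
move=> a; rewrite -(cone_reprK a) cone_mulE.
by apply: cone_class_ext => n /=; rewrite mul1g.
Qed.

Fact cone_1mul : right_id cone_one cone_mul.
Proof.
move=> a; rewrite -(cone_reprK a) cone_mulE.
by apply: cone_class_ext => n /=; rewrite mulg1.
Qed.

Fact cone_mulV : left_inverse cone_one cone_inv cone_mul.
Proof.
move=> a; rewrite -(cone_reprK a) cone_invE cone_mulE.
by apply: cone_class_ext => n /=; rewrite mulVg.
Qed.

Fact cone_Vmul : right_inverse cone_one cone_inv cone_mul.
Proof.
move=> a; rewrite -(cone_reprK a) cone_invE cone_mulE.
by apply: cone_class_ext => n /=; rewrite mulgV.
Qed.

HB.instance Definition _ := isGroup.Build cone
  cone_mulA cone_mul1 cone_1mul cone_mulV cone_Vmul.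

Lemma cone_mdistE x y :
  mdist (cone_class x) (cone_class y) = ulim w (seq_dist x y).
Proof. exact: cone_distE. Qed.

Lemma cone_mulgE x y :
  (cone_class x * cone_class y)%g = cone_class (adm_mul x y).
Proof. exact: cone_mulE. Qed.

End Cone.
Arguments adm_seq R {G} T.
Arguments cone R {G} T w.

Section Quasimorphism.
Context {R : realType} {G : groupType}.

Definition quasimorphism (psi : G -> R) : Prop :=
  exists2 D : R, 0 <= D & forall g h, `|psi (g * h)%g - psi g - psi h| <= D.

Definition expgz (g : G) (n : int) : G :=
  match n with Posz m => (g ^+ m)%g | Negz m => (g ^- m.+1)%g end.

Definition homogeneous (psi : G -> R) : Prop :=
  forall g (n : int), psi (expgz g n) = n%:~R * psi g.

Section Induced.
Context (T : conj_gen_set G) (w : np_ultrafilter) (psi : G -> R).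

(* Independent of the chosen representative, by cone_map_class below. *)
Definition cone_map (c : cone R T w) : R :=
  ulim w (fun n => psi (repr c n) / n%:R).

Hypotheses (psiq : quasimorphism psi) (psih : homogeneous psi).

Lemma quasimorphism_bound : exists2 D : R, 0 <= D &
  forall g h, psi (g * h)%g - psi g - psi h <= D /\
              - D <= psi (g * h)%g - psi g - psi h.
Proof.
have [D D0 HD] := psiq; exists D => // g h.
by have := HD g h; rewrite ler_norml => /andP[].
Qed.

Lemma homogeneousX g n : psi (g ^+ n)%g = n%:R * psi g.
Proof. by have := psih g (Posz n). Qed.

Lemma homogeneous1 : psi 1%g = 0.
Proof. by rewrite -[LHS]/(psi (1 ^+ 0)%g) homogeneousX mul0r. Qed.

Lemma nat_bounded_eq0 (a C : R) : (forall n : nat, n%:R * `|a| <= C) -> a = 0.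
Proof.
move=> aC; apply/eqP; rewrite -normr_eq0; apply: contraT => a0.
have a1 : 0 < `|a| by rewrite lt_neqAle eq_sym a0/=.
have C0 : 0 <= C by have := aC 0%N; rewrite mul0r.
have := aC (Num.truncn (C / `|a|)).+1.
rewrite -ler_pdivlMr// leNgt; apply: contraNT => _.
by apply: truncnS_gt.
Qed.

Lemma homogeneousJ g h : psi (g ^ h)%g = psi g.
Proof.
have [D D0 HD] := quasimorphism_bound.
pose C := D + D + `|psi h^-1%g| + `|psi h|.
have bnd k : `|psi (k ^ h)%g - psi k| <= C.
  have [H1 H2] := HD h^-1%g (k * h)%g; have [H3 H4] := HD k h.
  have := ler_norm (psi h); have := ler_norm (psi h^-1%g).
  have := ler_norm (- psi h); have := ler_norm (- psi h^-1%g).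
  rewrite !normrN /C conjgE ler_norml => *; apply/andP; split; lra.
apply/eqP; rewrite -subr_eq0; apply/eqP/(@nat_bounded_eq0 _ C) => n.
by have := bnd (g ^+ n)%g; rewrite conjXg !homogeneousX -mulrBr normrM normr_nat.
Qed.

Lemma homogeneous_lipschitz : exists2 K : R, 0 <= K &
  forall g, `|psi g| <= K * (word_norm T g)%:R.
Proof.
have [reps TE] := cgs_fin T; have [D D0 HD] := quasimorphism_bound.
pose M := \sum_(t <- reps) `|psi t|.
have M0 : 0 <= M by apply: sumr_ge0.
have TM t : cgs_set T t -> `|psi t| <= M.
  rewrite TE => -[g gr [h _ <-]]; rewrite homogeneousJ /M.
  by rewrite (big_rem g gr)/= lerDl sumr_ge0.
exists (M + D) => [|g]; first exact: addr_ge0.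
have [ts [Tts ->] <-] := word_normP T g.
elim: ts Tts => [|t ts IH] Tts.
  by rewrite big_nil homogeneous1 normr0 mulr0.
rewrite big_cons /= -natr1 mulrDr mulr1.
have {}IH : `|psi (\prod_(u <- ts) u)%g| <= (M + D) * (size ts)%:R.
  by apply: IH => u uts; apply: Tts; rewrite inE uts orbT.
have := TM t (Tts t (mem_head _ _)); move: IH.
have [H1 H2] := HD t (\prod_(u <- ts) u)%g.
rewrite !ler_norml => /andP[? ?] /andP[? ?]; apply/andP; split; lra.
Qed.

Lemma cone_map_class (x : adm_seq R T) :
  (fun n => psi (x n) / n%:R) @ npu_sets w --> cone_map (cone_class w x).
Proof.
have [K K0 psiK] := homogeneous_lipschitz.
have [D D0 HD] := quasimorphism_bound.
set y := repr (cone_class w x).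
have ycvg : (fun n => psi (y n) / n%:R) @ npu_sets w
    --> cone_map (cone_class w x).
  have [C yC] := adm_bounded y; apply: (@bounded_ucvg R w _ (K * C)) => n.
  rewrite normrM normfV normr_nat.
  rewrite (le_trans (ler_wpM2r _ (psiK _))) ?invr_ge0// -mulrA.
  by rewrite ler_wpM2l.
rewrite -[cone_map _]addr0.
rewrite (_ : (fun n => psi (x n) / n%:R) =
  (fun n => psi (y n) / n%:R + (psi (x n) - psi (y n)) / n%:R)); last first.
  by apply/funext => n; rewrite -mulrDl addrC subrK.
apply: cvgD => //.
pose v n := K * seq_dist T y x n + D * n%:R^-1.
have vcvg : v @ npu_sets w --> (0 : R).
  rewrite [X in _ --> X](_ : (0 : R) =
      K * ulim w (seq_dist T y x) + D * 0); last first.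
    by rewrite cone_repr_dist !mulr0 addr0.
  apply: cvgD; apply: cvgMl_tmp; first exact: seq_dist_cvg.
  by apply: npu_cvg; rewrite -cvg_shiftS; exact: cvg_harmonic.
apply/norm_cvg0P/(squeeze_cvgr _ (cvg_cst 0) vcvg); apply: nearW => n.
rewrite normr_ge0/= normrM normfV normr_nat /v /seq_dist mulrA -mulrDl.
rewrite ler_wpM2r ?invr_ge0//.
have := psiK (x n / y n)%g; rewrite -/(word_dist T (x n) (y n)) word_distC.
have [H1 H2] := HD (x n / y n)%g (y n); move: H1 H2; rewrite mulgVK.
by rewrite !ler_norml => ? ? /andP[? ?]; apply/andP; split; lra.
Qed.

End Induced.
End Quasimorphism.

Section Kernel.
Context {G H : groupType} (f : UMagmaMorphism.type G H).
Local Open Scope group_scope.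

Definition gker : pred G := fun x => f x == 1.

Fact gker_group_closed : group_closed gker.
Proof.
split=> [|x y]; rewrite -!topredE /= /gker ?gmulf1// => /eqP fx /eqP fy.
by rewrite gmulfF fx fy divg1.
Qed.

Definition ker_group : Type := {x | gker x}.
HB.instance Definition _ := SubChoice.on ker_group.
HB.instance Definition _ :=
  SubChoice_isSubGroup.Build G gker ker_group gker_group_closed.

End Kernel.

Definition short_exact (A B C : groupType)
    (i : UMagmaMorphism.type A B) (p : UMagmaMorphism.type B C) : Prop :=
  [/\ injective i, range i = [set b | p b = 1%g] & range p = setT].

Definition homeomorphic (X Y : topologicalType) : Prop :=
  exists (f : X -> Y) (g : Y -> X),
    [/\ continuous f, continuous g, cancel f g & cancel g f].

(* Main.v *)
(* If psi g <> 0, then t |-> [g ^ floor (t n)] is a one-parameter subgroup of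
   the cone: the rounding errors are bounded, hence vanish after division by n,
   and it is Lipschitz with constant the word norm of g.  Since psi is
   homogeneous, psihat maps its point at time t to t * psi g, so rescaling time
   by 1 / psi g gives the section s.  The induced map psihat is additive because
   the defect of psi is bounded, and Lipschitz because psi is bounded by a
   multiple of the word norm.  Therefore c |-> (c * (s (psihat c))^-1, psihat c)
   is a homeomorphism with inverse (k, r) |-> k * s r. *)
Require Import Defs.
From HB Require Import structures.
From mathcomp Require Import all_boot all_order all_algebra.
From mathcomp Require Import all_classical all_reals all_analysis.
From mathcomp Require Import lra.

Set Implicit Arguments.
Unset Strict Implicit.
Unset Printing Implicit Defensive.

Import Order.TTheory GRing.Theory Num.Theory.
Import numFieldNormedType.Exports.

Local Open Scope classical_set_scope.
Local Open Scope ring_scope.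

(** * Integer powers and their word norm *)

Section IntegerPowers.
Context {G : groupType}.
Implicit Types (g : G) (m n : int).

Lemma expgzS g n : expgz g (n + 1) = (expgz g n * g)%g.
Proof.
case: n => n; first by rewrite addrC -intS /= expgSr.
rewrite NegzE intS opprD addrAC addNr add0r -NegzE.
by case: n => [|n]; rewrite -?NegzE /= ?mulVg// [in RHS]expgS invgM mulgVK.
Qed.

Lemma expgzD g m n : expgz g (m + n) = (expgz g m * expgz g n)%g.
Proof.
elim/int_rect: n => [|n IH|n IH]; first by rewrite addr0 /= mulg1.
  by rewrite intS [1 + _]addrC addrA !expgzS IH mulgA.
(* Multiplying by [g] on the right raises the exponent by 1, so the downward step also reduces to
   [expgzS] and [IH]. *)
apply: (@mulIg _ g); rewrite -mulgA -!expgzS -addrA.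
by rewrite intS opprD addrAC addNr add0r.
Qed.

Lemma expgzB g m n : expgz g (m - n) = (expgz g m / expgz g n)%g.
Proof. by apply: (@mulIg _ (expgz g n)); rewrite -expgzD subrK mulgVK. Qed.

Lemma word_normX (T : conj_gen_set G) g (n : nat) :
  (word_norm T (g ^+ n)%g <= n * word_norm T g)%N.
Proof.
elim: n => [|n IH]; first by rewrite word_norm1.
by rewrite expgS mulSn (leq_trans (word_normM _ _ _))// leq_add2l.
Qed.

Lemma word_norm_expgz (T : conj_gen_set G) g n :
  (word_norm T (expgz g n) <= `|n| * word_norm T g)%N.
Proof.
by case: n => n; rewrite ?NegzE ?abszN /= ?word_normV word_normX.
Qed.

End IntegerPowers.

(** * Uniform bounds on rounding errors *)

Section FloorBounds.
Context {R : realType}.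
Implicit Types x y : R.

Lemma floorB_norm x y :
  `|(Num.floor x - Num.floor y)%:~R| <= `|x - y| + 1 :> R.
Proof.
have /andP[x1 x2] := floor_itv x; have /andP[y1 y2] := floor_itv y.
move: x1 x2 y1 y2; rewrite !intrD => x1 x2 y1 y2.
have := ler_norm (x - y); have := ler_norm (- (x - y)); rewrite normrN.
by move=> ? ?; rewrite intrN ler_norml; apply/andP; split; lra.
Qed.

(** The difference is a combination of three fractional parts, hence bounded independently of [x]
    and [y]; this is what makes [cone_line] additive. *)
Lemma floorD_norm x y :
  `|(Num.floor (x + y) - (Num.floor x + Num.floor y))%:~R| <= 2 :> R.
Proof.
have /andP[x1 x2] := floor_itv x; have /andP[y1 y2] := floor_itv y.
have /andP[z1 z2] := floor_itv (x + y).
move: x1 x2 y1 y2 z1 z2; rewrite !(intrD, intrN) => *.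
by rewrite ler_norml; apply/andP; split; lra.
Qed.

End FloorBounds.

(** * Metric group structure of the cone and its one-parameter subgroups *)

Section ConeGroup.
Context {R : realType} {G : groupType} {T : conj_gen_set G}.
Context {w : np_ultrafilter}.
Implicit Types (a b c d : cone R T w) (x y : adm_seq R T) (g : G).

Lemma ucvg_div_nat0 (u : nat -> R) (C : R) : (forall n, `|u n| <= C) ->
  (fun n => u n / n%:R) @ npu_sets w --> (0 : R).
Proof.
move=> uC.
have Ccvg : (fun n => C * n%:R^-1) @ npu_sets w --> (0 : R).
  rewrite [X in _ --> X](_ : (0 : R) = C * 0); last by rewrite mulr0.
  apply: cvgMl_tmp.
  (* The harmonic sequence is [1 / (n + 1)], hence the shift; ordinary limits are limits along
     [w]. *)
  by apply: npu_cvg; rewrite -cvg_shiftS; exact: cvg_harmonic.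
apply/norm_cvg0P/(squeeze_cvgr _ (cvg_cst 0) Ccvg); apply: nearW => n.
by rewrite normr_ge0/= normrM normfV normr_nat ler_wpM2r ?invr_ge0.
Qed.

Lemma cone_indP (P : cone R T w -> Prop) :
  (forall x, P (cone_class w x)) -> forall c, P c.
Proof. by move=> Px c; rewrite -(cone_reprK c). Qed.

(** The term [D / n] leaves room for bounded rounding errors, which disappear in the ultralimit. *)
Lemma cone_mdist_le x y (C D : R) :
  (forall n, seq_dist T x y n <= C + D / n%:R) ->
  mdist (cone_class w x) (cone_class w y) <= C.
Proof.
move=> xyC; rewrite cone_mdistE.
have Dcvg : (fun n => C + D / n%:R) @ npu_sets w --> (C + 0 : R).
  by apply: cvgD; [exact: cvg_cst | exact: (@ucvg_div_nat0 (cst D) `|D|)].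
rewrite -[C]addr0; apply: ler_cvg_to (@seq_dist_cvg _ _ _ w x y) Dcvg _.
exact: nearW.
Qed.

(** The word metric is bi-invariant because [T] is closed under conjugation, so the two factors can
    be replaced one at a time. *)
Lemma cone_mdist_mul a b c d :
  mdist (a * b)%g (c * d)%g <= mdist a c + mdist b d.
Proof.
move: a b c d; do 4![elim/cone_indP => ?]; rewrite !cone_mulgE !cone_mdistE.
by apply: ulim_seq_dist_sum => n; exact: word_distM.
Qed.

Lemma cone_mdist_inv a b : mdist a^-1%g b^-1%g = mdist a b.
Proof.
elim/cone_indP: a => x; elim/cone_indP: b => y.
rewrite -[(cone_class w x)^-1%g]/(cone_inv _).
rewrite -[(cone_class w y)^-1%g]/(cone_inv _) !cone_invE !cone_mdistE.
by congr ulim; apply/funext => n; rewrite /seq_dist word_distV.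
Qed.

Lemma cone_mdist_div_le a b : mdist (a / b)%g 1%g <= mdist a b.
Proof.
have := cone_mdist_mul a b^-1%g b b^-1%g.
by rewrite mulgV mdistxx addr0.
Qed.

(** The arbitrary filter lets this give continuity of pointwise products of cone-valued maps on any
    space. *)
Lemma cvg_cone_mul {I : Type} {F : set_system I} {FF : Filter F}
    (u v : I -> cone R T w) a b :
  u @ F --> a -> v @ F --> b -> (fun i => u i * v i)%g @ F --> (a * b)%g.
Proof.
move=> ua vb; apply/metricType_numDomainType.cvgrPdist_lt => e e0.
have e2 : 0 < e / 2 by rewrite divr_gt0.
apply: filterS (filterI (metricType_numDomainType.cvgr_dist_lt ua e2)
  (metricType_numDomainType.cvgr_dist_lt vb e2)) => i [/= uai vbi].
by rewrite (splitr e) (le_lt_trans (cone_mdist_mul _ _ _ _))// ltrD.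
Qed.

Definition floor_pow g (t : R) (n : nat) : G :=
  expgz g (Num.floor (t * n%:R)).

Lemma expgz_dist g (m n : int) :
  (word_dist T (expgz g m) (expgz g n))%:R <=
    `|(m - n)%:~R| * (word_norm T g)%:R :> R.
Proof.
rewrite /word_dist -expgzB -intr_norm -natr_absz -natrM ler_nat.
exact: word_norm_expgz.
Qed.

Lemma floor_pow_dist g t u n :
  seq_dist T (floor_pow g t) (floor_pow g u) n <=
    `|t - u| * (word_norm T g)%:R + (word_norm T g)%:R / n%:R.
Proof.
(* At [n = 0] division by zero returns 0, so the bound there is mere nonnegativity. *)
rewrite /seq_dist; have [->|n0] := eqVneq n 0%N.
  by rewrite invr0 !mulr0 addr0 mulr_ge0.
have n1 : 0 < n%:R :> R by rewrite ltr0n lt0n.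
rewrite ler_pdivrMr// (le_trans (expgz_dist _ _ _))//.
rewrite mulrDl divfK ?gt_eqF// mulrAC.
rewrite -[X in _ <= _ + X]mul1r -[leRHS]mulrDl ler_wpM2r//.
by rewrite (le_trans (floorB_norm _ _))// -mulrBl normrM normr_nat.
Qed.

Fact floor_pow_bounded g t : exists C : R,
  forall n, (word_norm T (floor_pow g t n))%:R / n%:R <= C.
Proof.
exists (`|t| * (word_norm T g)%:R + (word_norm T g)%:R) => n.
(* At [u = 0] the second sequence is constantly 1, so the distance is the norm. *)
have := floor_pow_dist g t 0 n; rewrite /seq_dist /word_dist.
rewrite {2}/floor_pow mul0r floor0 /= divg1 subr0 => /le_trans; apply.
rewrite lerD2l; case: n => [|n]; first by rewrite invr0 mulr0.
by rewrite ler_piMr// invf_le1// ler1n.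
Qed.

Definition cone_line g t : cone R T w :=
  cone_class w (AdmSeq (floor_pow_bounded g t)).

Lemma cone_line_lipschitz g t u :
  mdist (cone_line g t) (cone_line g u) <= (word_norm T g)%:R * `|t - u|.
Proof.
by rewrite mulrC; apply: cone_mdist_le => n; exact: floor_pow_dist.
Qed.

Lemma cone_lineD g t u :
  cone_line g (t + u) = (cone_line g t * cone_line g u)%g.
Proof.
apply: mdist_positivity; apply/eqP; rewrite eq_le mdist_ge0 andbT.
(* The exponents differ by at most 2, so the representatives stay within twice the norm of [g]: the
   bound holds with [C = 0]. *)
rewrite cone_mulgE; apply: (@cone_mdist_le _ _ _ (2 * (word_norm T g)%:R)) => n.
rewrite add0r /seq_dist ler_wpM2r ?invr_ge0//= /floor_pow -expgzD.
rewrite (le_trans (expgz_dist _ _ _))// ler_wpM2r// mulrDl.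
exact: floorD_norm.
Qed.

End ConeGroup.

(** * The induced map: additivity, Lipschitz bound, values on lines *)

Section ConeMap.
Context {R : realType} {G : groupType} {T : conj_gen_set G}.
Context {w : np_ultrafilter} {psi : G -> R}.
Implicit Types (a b : cone R T w) (g : G).
Hypotheses (psiq : quasimorphism psi) (psih : homogeneous psi).
Local Notation psihat := (@cone_map R G T w psi).

Lemma cone_map_mul a b : psihat (a * b)%g = psihat a + psihat b.
Proof.
elim/(@cone_indP R G T w): a => x; elim/(@cone_indP R G T w): b => y.
rewrite cone_mulgE.
have [D _ psiD] := psiq.
apply/eqP; rewrite -subr_eq0 opprD addrA; apply/eqP.
have xycvg := @cone_map_class R G T w psi psiq psih (adm_mul x y).
have xcvg := @cone_map_class R G T w psi psiq psih x.
have ycvg := @cone_map_class R G T w psi psiq psih y.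
(* The same sequence is the defect of [psi] divided by [n]; the defect is bounded by [D], so the
   limit is also 0. *)
apply: (cvg_unique _ (cvgB (cvgB xycvg xcvg) ycvg)) => //.
rewrite [X in X @ _](_ : _ =
  (fun n => (psi (x n * y n)%g - psi (x n) - psi (y n)) / n%:R)).
  exact: (@ucvg_div_nat0 _ _ _ D).
by apply/funext => n /=; rewrite !fctE /= !mulrBl.
Qed.

Lemma cone_map1 : psihat 1%g = 0.
Proof.
by apply: (@addrI _ (psihat 1%g)); rewrite -cone_map_mul mulg1 addr0.
Qed.

Lemma cone_mapV a : psihat a^-1%g = - psihat a.
Proof.
by apply: (@addrI _ (psihat a)); rewrite -cone_map_mul mulgV cone_map1 subrr.
Qed.

Lemma cone_map_lipschitz : exists2 K : R, 0 <= K &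
  forall a b, `|psihat a - psihat b| <= K * mdist a b.
Proof.
have [K K0 psiK] := homogeneous_lipschitz T psiq psih.
exists K => // a b; rewrite -cone_mapV -cone_map_mul.
(* It remains to compare one element with 1, where the bound of [psi] by [K] times the norm passes
   to the limit. *)
apply: (le_trans _ (ler_wpM2l K0 (cone_mdist_div_le a b))).
elim/(@cone_indP R G T w): (a / b)%g => x; rewrite cone_mdistE.
pose one := @adm_one R G T.
have ncvg : (fun n => `|psi (x n) / n%:R|) @ npu_sets w -->
    `|psihat (cone_class w x)|.
  by apply: cvg_norm; exact: cone_map_class.
have dcvg : (fun n => K * seq_dist T x one n) @ npu_sets w -->
    K * ulim w (seq_dist T x one).
  by apply: cvgMl_tmp; exact: seq_dist_cvg.
apply: ler_cvg_to ncvg dcvg _.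
apply: nearW => n /=; rewrite /seq_dist /word_dist /= divg1.
by rewrite normrM normfV normr_nat mulrA ler_wpM2r ?invr_ge0.
Qed.

Lemma cone_map_line g t : psihat (cone_line g t) = t * psi g.
Proof.
have lcvg := @cone_map_class R G T w psi psiq psih
  (AdmSeq (floor_pow_bounded g t)).
apply: (cvg_unique _ lcvg) => //; rewrite -[t * psi g]addr0.
(* Homogeneity turns the power into the factor [floor (t * n)]; this isolates its rounding error. *)
have dcvg : (fun n => ((Num.floor (t * n%:R))%:~R - t * n%:R) * psi g / n%:R)
    @ npu_sets w --> (0 : R).
  apply: (@ucvg_div_nat0 _ _ _ `|psi g|) => n.
  rewrite normrM ler_piMl//; have /andP[] := floor_itv (t * n%:R).
  by rewrite intrD ler_norml => ? ?; apply/andP; split; lra.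
apply: cvg_trans (cvgD (cvg_cst (t * psi g)) dcvg).
(* Cancelling [n] requires [n > 0], which holds on a set of [w]. *)
apply: near_eq_cvg; apply: filterS (npu_ge w 1) => n /= n0.
rewrite /floor_pow psih fctE /= !mulrBl; rewrite [t * n%:R * _]mulrAC mulfK.
  by rewrite addrC subrK.
by rewrite pnatr_eq0 -lt0n.
Qed.

End ConeMap.

(* R itself has no metricType instance; only its alias R^o does. *)
Lemma mdist_regular {R : realType} (x y : R^o) : mdist x y = `|x - y|.
Proof. by rewrite distrC. Qed.

Lemma lipschitz_continuous {R : realType} {X Y : metricType R} (f : X -> Y)
    (K : R) : (forall a b, mdist (f a) (f b) <= K * mdist a b) -> continuous f.
Proof.
move=> fK a; apply/metricType_numDomainType.cvgrPdist_lt => e e0.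
(* [K] may be zero or negative, so a positive upper bound of it serves as divisor. *)
have K1 : 0 < `|K| + 1 by rewrite ltr_wpDl.
have near_a : \forall b \near a, mdist a b < e / (`|K| + 1).
  apply: metricType_numDomainType.cvgr_dist_lt (divr_gt0 e0 K1).
  exact: cvg_id.
apply: filterS near_a => b; rewrite ltr_pdivlMr// => abe.
apply: le_lt_trans (fK _ _) _.
apply: le_lt_trans abe; rewrite mulrC ler_wpM2l ?mdist_ge0//.
by rewrite (le_trans (ler_norm K))// lerDl.
Qed.

(** * Exactness and the topological splitting *)

Section Splitting.
Context {R : realType} {G : groupType} {T : conj_gen_set G}.
Context {w : np_ultrafilter} {psi : G -> R}.
Hypotheses (psiq : quasimorphism psi) (psih : homogeneous psi).
Local Notation psihat := (@cone_map R G T w psi).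

Lemma cone_map_continuous : continuous psihat.
Proof.
have [K _ psiK] := @cone_map_lipschitz R G T w psi psiq psih.
apply: (@lipschitz_continuous R (cone R T w) R^o psihat K) => a b.
by rewrite mdist_regular; exact: psiK.
Qed.

(** Exactness at the kernel and in the middle is built into [ker_group], which leaves
    surjectivity. *)
Lemma cone_map_exact : (forall r, exists c, psihat c = r) ->
  exists f : UMagmaMorphism.type (cone R T w) (Algebra.to_multiplicative R),
    (f : cone R T w -> R) =1 psihat /\
    short_exact (\val : ker_group f -> cone R T w) f.
Proof.
move=> psis.
(* The codomain is the additive group of [R] in multiplicative notation, so additivity becomes
   multiplicativity. *)
pose fhat : cone R T w -> Algebra.to_multiplicative R := psihat.
have fhatM : monoid.monoid_morphism fhat.
  by split; [exact: cone_map1 | exact: cone_map_mul].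
pose f : UMagmaMorphism.type (cone R T w) (Algebra.to_multiplicative R) :=
  HB.pack fhat (isUMagmaMorphism.Build _ _ fhat fhatM).
exists f; split => //; split; first exact: val_inj.
  apply/seteqP; split => [_ [k _ <-]|c /= /eqP fc].
    exact/eqP/(valP k).
  by exists (exist _ c fc).
by apply/seteqP; split => // r _; have [c <-] := psis r; exists c.
Qed.

Lemma cone_map_split (s : R -> cone R T w) (L : R) :
  (forall r, psihat (s r) = r) ->
  (forall r1 r2, mdist (s r1) (s r2) <= L * `|r1 - r2|) ->
  homeomorphic (cone R T w)
    (set_type [set c : cone R T w | psihat c = 0] * R)%type.
Proof.
move=> sK sL.
have scont : continuous s.
  apply: (@lipschitz_continuous R R^o (cone R T w) s L) => a b.
  by rewrite mdist_regular; exact: sL.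
have Vcont : continuous (fun c : cone R T w => c^-1%g).
  apply: (@lipschitz_continuous R _ _ _ 1) => a b.
  by rewrite cone_mdist_inv mul1r.
pose proj (c : cone R T w) : cone R T w := (c / s (psihat c))%g.
have proj0 c : proj c \in [set c : cone R T w | psihat c = 0].
  apply/mem_set.
  by rewrite /= (cone_map_mul psiq psih) (cone_mapV psiq psih) sK subrr.
have proj_cont : continuous proj.
  move=> c; apply: (cvg_cone_mul (F := nbhs c) (u := id)); first exact: cvg_id.
  apply: continuous_comp; last exact: Vcont.
  by apply: continuous_comp; [exact: cone_map_continuous | exact: scont].
pose projK c : set_type [set c : cone R T w | psihat c = 0] :=
  exist _ (proj c) (proj0 c).
(* The kernel carries the initial topology of its inclusion, so continuity is tested after composing
   with it. *)
have projK_cont : continuous projK.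
  by apply: continuous_comp_initial; exact: proj_cont.
exists (fun c => (projK c, psihat c)),
  (fun p => set_val p.1 * s p.2)%g; split.
- move=> c; apply: (cvg_pair (F := nbhs c)
    (G := nbhs (projK c)) (H := nbhs (psihat c))); first exact: projK_cont.
  exact: cone_map_continuous.
- move=> p; apply: (cvg_cone_mul (F := nbhs p)).
    apply: continuous_comp; first exact: cvg_fst.
    exact: initial_continuous.
  by apply: continuous_comp; [exact: cvg_snd | exact: scont].
- by move=> c; rewrite /= /proj mulgVK.
- move=> [[k kP] r].
  (* Since [k] lies in the kernel, the product remembers [r]; dividing by [s r] then recovers
     [k]. *)
  have pr : psihat (k * s r)%g = r.
    have /= k0 := set_mem kP.
    by rewrite (cone_map_mul psiq psih) k0 sK add0r.
  congr pair => //; apply: val_inj.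
  by rewrite /= /proj pr mulgK.
Qed.

End Splitting.

Theorem lemma3p13 (R : realType) (G : groupType) (T : conj_gen_set G)
    (psi : G -> R) (psi_quasi : quasimorphism psi) (psi_homo : homogeneous psi)
    (psi_nontriv : exists g, psi g <> 0) (w : np_ultrafilter) :
  let psihat : cone R T w -> R := @cone_map R G T w psi in
  [/\ exists f : UMagmaMorphism.type (cone R T w) (Algebra.to_multiplicative R),
        (f : cone R T w -> R) =1 psihat /\
        short_exact (\val : ker_group f -> cone R T w) f,
      exists s : R -> cone R T w,
        [/\ forall r, psihat (s r) = r,
            forall r1 r2, s (r1 + r2) = (s r1 * s r2)%g &
            exists2 L : R, 0 <= L &
              forall r1 r2, mdist (s r1) (s r2) <= L * `|r1 - r2|]
    & homeomorphic (cone R T w)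
        (set_type [set c : cone R T w | psihat c = 0] * R)%type].
Proof.
have [g /eqP g0] := psi_nontriv => psihat.
pose s r : cone R T w := cone_line g (r / psi g).
have sK r : psihat (s r) = r.
  by rewrite [LHS](cone_map_line psi_quasi psi_homo) divfK.
(* Rescaling time by [1 / psi g] divides the Lipschitz constant of the line by the absolute value of
   [psi g]. *)
pose L := (word_norm T g)%:R / `|psi g|.
have sL r1 r2 : mdist (s r1) (s r2) <= L * `|r1 - r2|.
  rewrite (le_trans (cone_line_lipschitz _ _ _))//.
  by rewrite -mulrBl normrM normfV mulrA mulrAC.
split.
- by apply: cone_map_exact => // r; exists (s r); exact: sK.
- exists s; split => // [r1 r2|]; first by rewrite /s mulrDl cone_lineD.
  by exists L => //; rewrite divr_ge0.
- exact: cone_map_split sK sL.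
Qed.
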